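(* Let $q=2^\nu$ and $n=n_02^r$ for some $\nu\ge 1$, $r\ge 1$ and odd $n_0\ge1$, let $k,T$ be integers with $0\le T<k$, and let $\theta(\alpha)=\alpha^{q^T}$ on $\mathbb{F}_{q^k}$. Let $g(x)$ be a monic divisor of $x^n-1$ over $\mathbb{F}_{q^k}$ of the form $$g(x)=\left(\prod_{Q\in \Omega_1} f_Q(x)^{a_Q}\right)\left(\prod_{Q\in \Omega_2}\ \prod_{R\in \mathcal O(Q)} f_R(x)^{a_R}\right),$$ where $0\le a_Q,a_R\le 2^r$. Then the cyclic code $C=\langle g(x)\rangle$ of length $n$ over $\mathbb{F}_{q^k}$ is $\theta$-self-dual if and only if $a_Q=2^{r-1}$ for every $Q\in \Omega_1$, and $$a_R=2^r-a_{\sigma^{-1}(R)}$$ for every $R$ in a $\sigma$-orbit represented by some element of $\Omega_2$.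
   Context: Cyclic codes of length $n$ over $\mathbb{F}_{q^k}$ are identified with ideals of $\mathbb{F}_{q^k}[x]/\langle x^n-1\rangle$ via $(c_0,\dots,c_{n-1})\mapsto\sum c_ix^i$. The $\theta$-form on $\mathbb{F}_{q^k}^n$ is $[u,v]_\theta=\sum_{i=0}^{n-1}u_i\theta(v_i)$, and $C^{\perp_\theta}=\{v\in\mathbb{F}_{q^k}^n:[v,c]_\theta=0\text{ for all }c\in C\}$. The code $C$ is $\theta$-self-dual (Galois self-dual) if $C=C^{\perp_\theta}$. The $q^k$-cyclotomic class of $i\in\mathbb{Z}_{n_0}$ is $\{q^{kj}i\bmod n_0:j\ge0\}$. Fix a primitive $n_0$th root of unity $\zeta$ in an extension of $\mathbb{F}_{q^k}$ and set $f_Q(x)=\prod_{i\in Q}(x-\zeta^i)$ for each $q^k$-cyclotomic class $Q\subseteq\mathbb{Z}_{n_0}$; these are the monic irreducible factors of $x^{n_0}-1$ over $\mathbb{F}_{q^k}$. Let $\sigma$ be the permutation $\sigma(Q)=-q^TQ=\{-q^Ti\bmod n_0:i\in Q\}$ of the set of $q^k$-cyclotomic classes modulo $n_0$, and let $\mathcal{O}(Q)$ be the $\sigma$-orbit of $Q$. Choose one representative in each $\sigma$-orbit; $\Omega_1$ is the set of representatives of the orbits of size $1$, and $\Omega_2$ is the set of representatives of the orbits of size greater than $1$. Then $x^n-1=\bigl(\prod_{Q\in\Omega_1}f_Q(x)^{2^r}\bigr)\bigl(\prod_{Q\in\Omega_2}\prod_{R\in\mathcal{O}(Q)}f_R(x)^{2^r}\bigr)$.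 *)

(* Defs.v *)
From mathcomp Require Import all_boot all_order all_algebra.

Set Implicit Arguments.
Unset Strict Implicit.
Unset Printing Implicit Defensive.

Import GRing.Theory.

Local Open Scope ring_scope.

(* The residues mod n0, for n0 > 0: in this form the ordinals carry their
   additive group structure, including for n0 = 1 (which 'Z_n0 does not
   cover). *)
Notation residue n0 := 'I_n0.-1.+1 (only parsing).

Section CyclotomicClasses.

Variables (n0 q k T : nat).

(* fingraph's orbit: the iterates i, q^k i, q^(2k) i, ... *)
Definition cyclotomic_class (i : residue n0) : {set residue n0} :=
  [set j in orbit (fun l : residue n0 => l *+ (q ^ k)%N) i].

Definition cyclotomic_classes : {set {set residue n0}} :=
  [set cyclotomic_class i | i : residue n0].

(* Defined on all sets of residues. It is injective when q is coprime to n0,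
   and then finv gives its inverse. *)
Definition sigma (Q : {set residue n0}) : {set residue n0} :=
  [set - (i *+ (q ^ T)%N) | i in Q].

Definition sigma_inv : {set residue n0} -> {set residue n0} := finv sigma.

Definition sigma_orbit (Q : {set residue n0}) : {set {set residue n0}} :=
  [set R in orbit sigma Q].

Definition sigma_orbits : {set {set {set residue n0}}} :=
  [set sigma_orbit Q | Q in cyclotomic_classes].

Variable reps : {set {set residue n0}}.

Definition Omega1 : {set {set residue n0}} :=
  [set Q in reps | #|sigma_orbit Q| == 1%N].

Definition Omega2 : {set {set residue n0}} :=
  [set Q in reps | (1 < #|sigma_orbit Q|)%N].

End CyclotomicClasses.

Definition class_poly (L : fieldType) (n0 : nat) (zeta : L)
    (Q : {set residue n0}) : {poly L} :=
  \prod_(i in Q) ('X - (zeta ^+ i)%:P).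

Section Codes.

Variables (F : finFieldType) (n : nat).

(* rVpoly c is the polynomial \sum_i c_i 'X^i, and the ideal generated by g is
   taken in F[x]/<x^n - 1>. *)
Definition cyclic_code (g : {poly F}) : {set 'rV[F]_n} :=
  [set c | [exists u : {poly %/ 'X^n - 1 : {poly F}},
     in_qpoly ('X^n - 1) (rVpoly c) == u * in_qpoly ('X^n - 1) g]].

Definition theta_form (theta : F -> F) (u v : 'rV[F]_n) : F :=
  \sum_(i < n) u 0 i * theta (v 0 i).

Definition theta_dual (theta : F -> F) (C : {set 'rV[F]_n}) : {set 'rV[F]_n} :=
  [set v | [forall c in C, theta_form theta v c == 0]].

Definition theta_self_dual (theta : F -> F) (C : {set 'rV[F]_n}) : Prop :=
  C = theta_dual theta C.

End Codes.

(* Main.v *)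
Require Import Defs.
From HB Require Import structures.
From mathcomp Require Import all_boot all_order all_algebra finfield.

(** Over L the polynomial x^n - 1 is (x^n0 - 1)^(2^r), since the characteristic
is 2, so every power zeta^i is a root of multiplicity 2^r. The generator g has
at zeta^i the multiplicity m(i) = a_R, where R is the cyclotomic class of i.

The theta-form of v and c is the constant coefficient, in F[x]/<x^n - 1>, of
v(1/x) * theta(c)(x), where 1/x is x^(n-1) (theta_form_coef0). As the code is
closed under shifts, v lies in the theta-dual of <g> exactly when x^n - 1
divides v(1/x) * theta(g)(x) (mem_theta_dual). At zeta^(q^T i), the polynomial
theta(g) has multiplicity m(i), because theta extends to a Frobenius power of L;
there v(1/x) has the multiplicity of v at the inverse root, because n - 1 is
invertible in L (dvdp_XsubC_exp_comp_Xn). Hence v lies in the dual if and only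
if its multiplicity at zeta^(-q^T i) is at least 2^r - m(i), for all i
(dual_dvdpE).

Membership in <g> is the condition that the multiplicity at zeta^i be at least
m(i). Both sets of prescribed multiplicities are attained by polynomials over F,
so the code is self-dual if and only if m(-q^T i) + m(i) = 2^r for every i
(theta_self_dual_mup). Since sigma maps the class of i to that of -q^T i, this
says a_(sigma R) + a_R = 2^r for every class R, which read along the orbits of
sigma is the stated condition (sigma_pairing_Omega). *)

Set Implicit Arguments.
Unset Strict Implicit.
Unset Printing Implicit Defensive.

Import GRing.Theory.

Local Open Scope ring_scope.

(** * Root multiplicities *)

Section Multiplicity.

Variable K : fieldType.
Implicit Types (x : K) (A B : {poly K}).

Lemma dvdp_XsubC_exp_mulr x e A B : B != 0 ->
  (('X - x%:P) ^+ e %| A * B) = (('X - x%:P) ^+ (e - mup x B) %| A).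
Proof.
move=> nzB; have [-> | nzA] := eqVneq A 0; first by rewrite mul0r !dvdp0.
by rewrite -!mup_geq ?mulf_neq0 // mupM // leq_subLR addnC.
Qed.

Lemma mup_map_poly (K' : fieldType) (f : {rmorphism K -> K'}) x A : A != 0 ->
  mup (f x) (map_poly f A) = mup x A.
Proof.
move=> nzA; have geE e : (e <= mup (f x) (map_poly f A))%N = (e <= mup x A)%N.
  rewrite !mup_geq ?map_poly_eq0 //.
  by rewrite -(map_polyX f) -map_polyC -rmorphB -rmorphXn dvdp_map.
by apply/eqP; rewrite eqn_leq -geE leqnn geE leqnn.
Qed.

(** Where 'X^N is unramified at x, substituting 'X^N does not change
multiplicities: 'X^N - x^N has x as a simple root, because its derivative
N * x^(N-1) does not vanish there. *)
Lemma dvdp_XsubC_exp_comp_Xn x N e A : x != 0 -> N%:R != 0 :> K ->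
  (('X - x%:P) ^+ e %| A \Po 'X^N) = (('X - (x ^+ N)%:P) ^+ e %| A).
Proof.
move=> nzx nzN; have N_gt0 : (0 < N)%N by case: N nzN => //; rewrite eqxx.
have [-> | nzA] := eqVneq A 0; first by rewrite comp_poly0 !dvdp0.
have [m [u]] := multiplicity_XsubC A (x ^+ N); rewrite nzA /= => nru defA.
have [s defs] : exists s, 'X^N - (x ^+ N)%:P = s * ('X - x%:P).
  by apply/factor_theorem; rewrite rootE !hornerE subrr.
have nrs : ~~ root s x.
  (* The derivatives of both sides of defs at x give s.[x] = N x^(N-1). *)
  have /(congr1 (fun p => p^`().[x])) := defs.
  rewrite !derivE !hornerE subrr !mulr0 add0r subr0 hornerMn hornerXn => defsx.
  rewrite rootE -defsx -mulr_natl mulf_neq0 //.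
  exact: expf_neq0.
have nrc : ~~ root (u \Po 'X^N) x by rewrite rootE horner_comp hornerXn.
have nz0 (v : {poly K}) y : ~~ root v y -> v != 0.
  by apply: contraNneq => ->; rewrite root0.
have defC : A \Po 'X^N = (u \Po 'X^N) * s ^+ m * ('X - x%:P) ^+ m.
  rewrite defA comp_polyM rmorphXn /= comp_polyB comp_polyX comp_polyC defs.
  by rewrite exprMn mulrA.
have nrcs : ~~ root ((u \Po 'X^N) * s ^+ m) x.
  rewrite rootM negb_or nrc /=; apply: contra nrs.
  by rewrite /root horner_exp expf_eq0 => /andP[].
rewrite -!mup_geq //; last first.
  by rewrite defC mulf_neq0 ?(nz0 _ _ nrcs) // expf_neq0 // polyXsubC_eq0.
by rewrite defC defA !mupMr // !mup_XsubCX !eqxx.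
Qed.

Variables (I : finType) (x : I -> K) (e : I -> nat).
Hypothesis x_inj : injective x.

Lemma dvdp_prod_XsubC_exp A :
  (\prod_i ('X - (x i)%:P) ^+ e i %| A)
    = [forall i, ('X - (x i)%:P) ^+ e i %| A].
Proof.
suff dvd_seq (s : seq I) : uniq s ->
    (\prod_(i <- s) ('X - (x i)%:P) ^+ e i %| A)
      = all (fun i => ('X - (x i)%:P) ^+ e i %| A) s.
  rewrite dvd_seq ?index_enum_uniq //; apply/allP/forallP => dvdA i //.
  by apply: dvdA; rewrite mem_index_enum.
elim: s => [|i s IHs] /=; first by rewrite big_nil dvd1p.
case/andP=> s'i Us; rewrite big_cons Gauss_dvdp ?IHs //.
rewrite coprimep_expl // coprimep_sym coprimep_XsubC /root horner_prod.
rewrite prodf_seq_neq0; apply/allP => j sj /=; rewrite !hornerE.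
by rewrite expf_neq0 // subr_eq0 (inj_eq x_inj); apply: contraNneq s'i => ->.
Qed.

Lemma mup_prod_XsubC_exp i : mup (x i) (\prod_j ('X - (x j)%:P) ^+ e j) = e i.
Proof.
rewrite (bigD1 i) //= mupMl ?mup_XsubCX ?eqxx // /root horner_prod.
apply/prodf_neq0 => j neq_ji; rewrite !hornerE expf_neq0 // subr_eq0.
by rewrite (inj_eq x_inj) eq_sym.
Qed.

End Multiplicity.

(** * Reduction modulo x^n - 1 *)

Section CyclicReduction.

Variables (F : fieldType) (n : nat).
Hypothesis n_gt0 : (0 < n)%N.
Implicit Types u v w : {poly F}.

Local Notation P := ('X^n - 1 : {poly F}).

Lemma Xn_sub1_monic : P \is monic.
Proof. exact: monicXnsubC. Qed.

Lemma Xn_sub1_dvd_expX i j : i = j %[mod n] -> P %| 'X^i - 'X^j.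
Proof.
wlog le_ij : i j / (j <= i)%N.
  move=> IH; case/orP: (leq_total j i) => [/IH // | le_ij eq_ij].
  by rewrite -['X^i - _]opprB dvdpNr IH.
move/eqP; rewrite eqn_mod_dvd // => /dvdnP[m def_ij].
have ->: 'X^i - 'X^j = 'X^j * ('X^n ^+ m - 1) :> {poly F}.
  by rewrite mulrBr mulr1 -exprM -exprD mulnC -def_ij subnKC.
by rewrite dvdp_mull // -{2}(expr1n {poly F} m) subrXX dvdp_mulr.
Qed.

Lemma Xn_sub1_dvd_comp i j u :
  i = j %[mod n] -> P %| (u \Po 'X^i) - (u \Po 'X^j).
Proof.
move=> eq_ij; rewrite !comp_polyE -sumrB.
apply: (big_ind (dvdp P)) => [|v w|l _]; rewrite ?dvdp0 //.
  exact: dvdp_add.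
rewrite -scalerBr -mul_polyC dvdp_mull // -!exprM Xn_sub1_dvd_expX //.
by rewrite -modnMml eq_ij modnMml.
Qed.

Lemma size_modp_Xn_sub1 u : (size (u %% P)%R <= n)%N.
Proof.
have := ltn_modp u P; rewrite size_XnsubC // ltnS => ->.
exact/monic_neq0/Xn_sub1_monic.
Qed.

(** The constant coefficient of the remainder modulo 'X^n - 1 is the linear
form that detects exponents divisible by n; it expresses the theta-form as a
product of polynomials. *)
Lemma coef0_modp_Xn m : ('X^m %% P)`_0 = (n %| m)%:R.
Proof.
have -> : 'X^m %% P = 'X^(m %% n).
  have /dvdpP[s def_s]: P %| 'X^m - 'X^(m %% n).
    by apply: Xn_sub1_dvd_expX; rewrite modn_mod.
  rewrite -['X^m](subrK 'X^(m %% n)) def_s modpD modp_mull add0r modp_small //.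
  by rewrite size_polyXn size_XnsubC // !ltnS ltn_mod.
by rewrite coefXn eq_sym.
Qed.

(** The pairing (u, w) |-> constant coefficient of u * w is nondegenerate on
F[x]/<x^n - 1>: multiplying by 'X^(n - l) moves the coefficient of 'X^l to the
constant term. *)
Lemma dvdp_Xn_sub1P u :
  P %| u <-> forall j, ((u * 'X^j) %% P)`_0 = 0.
Proof.
split=> [dvd_u j | coef_u].
  by rewrite (modp_eq0 (dvdp_mulr _ dvd_u)) coef0.
pose w := u %% P.
have szw : (size w <= n)%N := size_modp_Xn_sub1 u.
have coefw j : ((w * 'X^j) %% P)`_0 = 0.
  by rewrite -[RHS](coef_u j) mulrC modp_mul mulrC.
suff w0 : w = 0 by rewrite /dvdp -/w w0.
apply/polyP=> l; rewrite coef0; case: (ltnP l n) => [lt_ln | le_nl]; last first.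
  by rewrite nth_default // (leq_trans szw).
rewrite -[RHS](coefw (n - l)%N) -[w in RHS]coefK poly_def mulr_suml.
rewrite (big_morph _ (modpD _) (mod0p _)) coef_sum.
have lw (i : 'I_(size w)) : (('X^i * 'X^(n - l)) %% P)`_0 = (i == l :> nat)%:R.
  rewrite -exprD coef0_modp_Xn; congr (_%:R).
  have lt_in : (i < n)%N by apply: leq_trans szw.
  rewrite addnBA ?(ltnW lt_ln) // -eqn_mod_dvd ?modnDr ?modn_small //.
  by rewrite ltnW // ltn_addl.
under eq_bigr do rewrite -scalerAl modpZl coefZ lw.
case: (ltnP l (size w)) => [lt_lw | le_wl].
  rewrite (bigD1 (Ordinal lt_lw)) //= eqxx mulr1 big1 ?addr0 // => i.
  by rewrite -val_eqE /= => /negPf->; rewrite mulr0.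
rewrite nth_default // big1 // => i _; rewrite ltn_eqF ?mulr0 //.
exact: leq_trans le_wl.
Qed.

End CyclicReduction.

(** * Duality of cyclic codes *)

Section CyclicDuality.

Variables (F : finFieldType) (n : nat) (theta : {rmorphism F -> F}).
Hypothesis n_gt0 : (0 < n)%N.
Implicit Types (u w : {poly F}) (v c : 'rV[F]_n).

Local Notation P := ('X^n - 1 : {poly F}).

Lemma rVpoly_sum v : rVpoly v = \sum_(i < n) v 0 i *: 'X^i.
Proof.
rewrite {1}[v]row_sum_delta linear_sum; apply: eq_bigr => i _.
by rewrite linearZ /= rVpoly_delta.
Qed.

(** Modulo x^n - 1, substituting 'X^(n-1) is substituting the inverse of 'X, so
the constant term of v(1/x) * theta(c)(x) collects the products of the
coefficients of equal index. *)
Lemma theta_form_coef0 v c :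
  theta_form theta v c =
    (((rVpoly v \Po 'X^(n.-1)) * map_poly theta (rVpoly c)) %% P)`_0.
Proof.
rewrite map_rVpoly !rVpoly_sum rmorph_sum /= mulr_suml.
rewrite (big_morph _ (modpD _) (mod0p _)) coef_sum; apply: eq_bigr => i _.
rewrite mulr_sumr (big_morph _ (modpD _) (mod0p _)) coef_sum.
have termE (j : 'I_n) :
    (((v 0 i *: 'X^i \Po 'X^(n.-1)) * (map_mx theta c 0 j *: 'X^j)) %% P)`_0
    = v 0 i * theta (c 0 j) * (j == i)%:R.
  rewrite comp_polyZ comp_Xn_poly -scalerAl -scalerAr scalerA modpZl coefZ mxE.
  rewrite -exprM -exprD coef0_modp_Xn //; congr (_ * _%:R).
  (* Adding i turns (n - 1) i into n i, which leaves j = i modulo n. *)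
  have -> : (n %| n.-1 * i + j)%N = (i + (n.-1 * i + j) == i + 0 %[mod n]).
    by rewrite eqn_modDl mod0n.
  by rewrite addnA -mulSn prednK // addn0 mulnC modnMDl !modn_small.
under eq_bigr do rewrite termE.
rewrite (bigD1 i) //= eqxx mulr1 big1 ?addr0 // => j.
by move/negPf->; rewrite mulr0.
Qed.

Variable g : {poly F}.
Hypothesis g_dvd : g %| P.

Lemma mem_cyclic_code c : (c \in cyclic_code n g) = (g %| rVpoly c).
Proof.
have mkP : mk_monic P = P.
  by rewrite /mk_monic size_XnsubC // ltnS n_gt0 Xn_sub1_monic.
have monP := Xn_sub1_monic F n_gt0.
rewrite inE; apply/existsP/idP => [[[u ?] /eqP/(congr1 val)] | /dvdpP[w def_c]].
  rewrite /= mkP -!(Pdiv.IdomainMonic.modpE monP) modp_mul => def_c.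
  by rewrite (dvdp_mod _ g_dvd) def_c -(dvdp_mod _ g_dvd) dvdp_mull.
by exists (in_qpoly P w); rewrite def_c in_qpolyM.
Qed.

(** Orthogonality to g kills only the constant coefficient of
v(1/x) * theta(g)(x) in F[x]/<x^n - 1>; orthogonality to the cyclic shifts of g,
which also lie in the code, kills all the others. *)
Lemma mem_theta_dual v :
  (v \in theta_dual theta (cyclic_code n g)) =
    (P %| (rVpoly v \Po 'X^(n.-1)) * map_poly theta g).
Proof.
rewrite inE; apply/forall_inP/idP => [dual_v | dvd_v c].
  apply/dvdp_Xn_sub1P => // j.
  have szw := size_modp_Xn_sub1 n_gt0 (g * 'X^j).
  have /dual_v/eqP : poly_rV ((g * 'X^j) %% P) \in cyclic_code n g.
    by rewrite mem_cyclic_code poly_rV_K // -dvdp_mod // dvdp_mulr.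
  rewrite theta_form_coef0 poly_rV_K // map_modp !(rmorphM, rmorphB) /=.
  by rewrite rmorph1 !map_polyXn modp_mul mulrA.
rewrite mem_cyclic_code => /dvdpP[w def_c]; rewrite theta_form_coef0 def_c.
rewrite rmorphM /= mulrCA; apply/eqP.
by rewrite (modp_eq0 (dvdp_mull _ dvd_v)) coef0.
Qed.

(** Both sides depend on w only modulo x^n - 1, hence the criterion may range
over all polynomials instead of those of size at most n. This covers the
degenerate generator x^n - 1, and lets w be any polynomial that witnesses a
divisibility. *)
Lemma theta_self_dualP :
  theta_self_dual theta (cyclic_code n g) <->
  forall w, (g %| w) = (P %| (w \Po 'X^(n.-1)) * map_poly theta g).
Proof.
split=> [dualC w | dualP]; last first.
  by apply/setP=> v; rewrite mem_theta_dual mem_cyclic_code.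
have szw := size_modp_Xn_sub1 n_gt0 w.
have := mem_theta_dual (poly_rV (w %% P)).
rewrite -dualC mem_cyclic_code poly_rV_K // -dvdp_mod // => ->.
rewrite [w in RHS](divp_eq w P) comp_polyD comp_polyM mulrDl dvdp_addr //.
rewrite mulrAC dvdp_mull // comp_polyB comp_polyC comp_Xn_poly -exprM.
by apply: (@Xn_sub1_dvd_expX F n _ 0); rewrite modnMl mod0n.
Qed.

End CyclicDuality.

(** * Self-duality in terms of root multiplicities *)

Section RootCriterion.

Variables (F : finFieldType) (L : fieldType) (iota : {rmorphism F -> L}).
Variables (theta : {rmorphism F -> F}) (Theta : {rmorphism L -> L}).
Hypothesis Theta_iota : forall z, Theta (iota z) = iota (theta z).

Variables (n e : nat).
Hypothesis n_gt0 : (0 < n)%N.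
Hypothesis n1_neq0 : n.-1%:R != 0 :> L.

Variables (I : finType) (x : I -> L) (twist sig : I -> I).
Hypothesis x_inj : injective x.
Hypothesis x_unity : forall i, x i ^+ n = 1.
Hypothesis x_twist : forall i, x (twist i) = Theta (x i).
Hypothesis x_sig : forall i, x (sig i) = (Theta (x i))^-1.
Hypothesis Xn_sub1_prod : 'X^n - 1 = \prod_i ('X - (x i)%:P) ^+ e.

Variables (g : {poly F}) (m : I -> nat).
Hypothesis g_dvd : g %| 'X^n - 1.
Hypothesis iota_g : map_poly iota g = \prod_i ('X - (x i)%:P) ^+ m i.

Local Notation P := ('X^n - 1 : {poly F}).
Local Notation "p ^iota" := (map_poly iota p) (at level 2).
Local Notation g_theta := (map_poly theta g).

Let P_neq0 : P != 0.
Proof. exact/monic_neq0/Xn_sub1_monic. Qed.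

Let g_neq0 : g != 0.
Proof. by apply: contraNneq P_neq0 => g0; rewrite -dvd0p -g0. Qed.

Let x_neq0 i : x i != 0.
Proof.
apply/eqP=> xi0; have := x_unity i; rewrite xi0 expr0n gtn_eqF //.
by move/esym/eqP; rewrite oner_eq0.
Qed.

Let x_pred i : x i ^+ n.-1 = (x i)^-1.
Proof.
by apply: (mulfI (x_neq0 i)); rewrite -exprS prednK // x_unity mulfV.
Qed.

Let Xn_sub1_iota : P ^iota = \prod_i ('X - (x i)%:P) ^+ e.
Proof. by rewrite rmorphB /= map_polyXn rmorph1 Xn_sub1_prod. Qed.

Let twist_onto i : exists j, twist j = i.
Proof.
have twist_inj : injective twist.
  by move=> j k /(congr1 x); rewrite !x_twist => /fmorph_inj/x_inj.
by exists (invF twist_inj i); rewrite f_invF.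
Qed.

Let sig_onto i : exists j, sig j = i.
Proof.
have sig_inj : injective sig.
  by move=> j k /(congr1 x); rewrite !x_sig => /invr_inj/fmorph_inj/x_inj.
by exists (invF sig_inj i); rewrite f_invF.
Qed.

Lemma mup_theta_generator i : mup (x (twist i)) (g_theta ^iota) = m i.
Proof.
have -> : g_theta ^iota = map_poly Theta (g ^iota).
  by rewrite -!map_poly_comp; apply: eq_map_poly => z /=; rewrite Theta_iota.
by rewrite x_twist mup_map_poly ?map_poly_eq0 // iota_g mup_prod_XsubC_exp.
Qed.

Lemma generator_dvdpE w :
  (g %| w) = [forall i, ('X - (x i)%:P) ^+ m i %| w ^iota].
Proof. by rewrite -(dvdp_map iota) iota_g dvdp_prod_XsubC_exp. Qed.

(** The root x (twist i) of theta(g), of multiplicity m i, leaves e - m i to be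
supplied by w(1/x), that is, by w at the inverse root x (sig i). So the
theta-dual is cut out by the multiplicities e - m i at x (sig i). *)
Lemma dual_dvdpE w :
  (P %| (w \Po 'X^(n.-1)) * g_theta) =
    [forall i, ('X - (x (sig i))%:P) ^+ (e - m i) %| w ^iota].
Proof.
rewrite -(dvdp_map iota) Xn_sub1_iota dvdp_prod_XsubC_exp //.
rewrite rmorphM /= map_comp_poly map_polyXn.
have factorE i :
    (('X - (x (twist i))%:P) ^+ e %| (w ^iota \Po 'X^(n.-1)) * g_theta ^iota) =
    (('X - (x (sig i))%:P) ^+ (e - m i) %| w ^iota).
  rewrite dvdp_XsubC_exp_mulr ?map_poly_eq0 // mup_theta_generator.
  by rewrite dvdp_XsubC_exp_comp_Xn // x_pred x_twist x_sig.
apply/forallP/forallP => dvdw i; first by rewrite -factorE.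
by have [j <-] := twist_onto i; rewrite factorE.
Qed.

(** The code prescribes m at every root and its dual prescribes e - m i at
x (sig i). That equal codes have equal multiplicities needs a polynomial over F
in each code with exactly the prescribed ones: g for the code, and the
reciprocal h(1/x) of the check polynomial h = (x^n - 1) / theta(g) for the
dual. *)
Lemma theta_self_dual_mup :
  theta_self_dual theta (cyclic_code n g) <-> forall i, (m (sig i) + m i = e)%N.
Proof.
have dualP := theta_self_dualP theta n_gt0 g_dvd.
split=> [/dualP dualg i | dualm]; last apply/dualP => w.
  (* h(1/x) belongs to the dual, hence is a multiple of g: this gives the upper
     bound; that g itself belongs to the dual gives the lower one. *)
  apply/eqP; rewrite eqn_leq addnC -[X in _ && X]leq_subLR; apply/andP; split.
    have /dvdpP[h def_h] : g_theta %| P.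
      have := g_dvd; rewrite -(dvdp_map theta).
      by rewrite rmorphB /= map_polyXn rmorph1.
    have h_neq0 : h != 0.
      by apply: contraNneq P_neq0 => h0; rewrite def_h h0 mul0r.
    have mup_h : (mup (x (twist i)) (h ^iota) + m i)%N = e.
      rewrite -{1}mup_theta_generator -mupM ?map_poly_eq0 // -rmorphM -def_h /=.
      by rewrite Xn_sub1_iota mup_prod_XsubC_exp.
    have : g %| h \Po 'X^(n.-1).
      rewrite dualg -comp_polyA comp_Xn_poly -exprM.
      have -> : h \Po 'X^(n.-1 * n.-1) = ((h \Po 'X^(n.-1 * n.-1)) - h) + h.
        by rewrite subrK.
      rewrite mulrDl -def_h dvdp_addl // dvdp_mulr //.
      rewrite -{2}[h]comp_polyXr; apply: (@Xn_sub1_dvd_comp F n _ 1).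
      (* (n - 1)^2 = 1 modulo n, as adding n - 1 to both sides shows. *)
      apply/eqP; rewrite -(eqn_modDr n.-1) -mulnSr add1n prednK //.
      by rewrite modnMl modnn.
    rewrite generator_dvdpE => /forallP/(_ (sig i)).
    rewrite map_comp_poly map_polyXn dvdp_XsubC_exp_comp_Xn // x_pred x_sig.
    by rewrite invrK -x_twist -mup_geq ?map_poly_eq0 // -(leq_add2r (m i)) mup_h
      addnC.
  have : g %| g by []; rewrite dualg dual_dvdpE => /forallP/(_ i).
  by rewrite -mup_geq ?map_poly_eq0 // iota_g mup_prod_XsubC_exp // addnC.
rewrite generator_dvdpE dual_dvdpE; apply/forallP/forallP => dvdw i.
  by rewrite -(dualm i) addnK.
by have [j <-] := sig_onto i; rewrite -[m _](addnK (m j)) dualm.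
Qed.

End RootCriterion.

(** * Powers of the Frobenius map *)

Section FrobeniusPower.

Variables (R : comNzRingType) (p : nat).

(** The membership proof is an argument so that the morphism structures, which
rest on it, can be inferred from the term. *)
Definition frobenius_pow of p \in [pchar R] :=
  fun (m : nat) (z : R) => z ^+ (p ^ m).

Variables (pcharRp : p \in [pchar R]) (m : nat).

Fact frobenius_pow_zmod_morphism : zmod_morphism (frobenius_pow pcharRp m).
Proof.
have p_nat : [pchar R].-nat (p ^ m)%N.
  by rewrite pnatX (pnatE _ (pcharf_prime pcharRp)) pcharRp.
move=> y z; rewrite /frobenius_pow -[y in RHS](subrK z).
by rewrite [in RHS]exprDn_pchar // addrK.
Qed.

Fact frobenius_pow_monoid_morphism : monoid_morphism (frobenius_pow pcharRp m).
Proof.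
by split=> [|y z]; rewrite /frobenius_pow ?expr1n // exprMn.
Qed.

HB.instance Definition _ :=
  GRing.isZmodMorphism.Build R R (frobenius_pow pcharRp m)
    frobenius_pow_zmod_morphism.
HB.instance Definition _ :=
  GRing.isMonoidMorphism.Build R R (frobenius_pow pcharRp m)
    frobenius_pow_monoid_morphism.

End FrobeniusPower.

(** * Powers of zeta indexed by residues *)

Section ResiduePowers.

Variables (L : fieldType) (N : nat) (zeta : L).
Hypothesis prim_zeta : N.+1.-primitive_root zeta.
Implicit Types i j : 'I_N.+1.

Lemma prim_exprD_residue i j : zeta ^+ (i + j)%R = zeta ^+ i * zeta ^+ j.
Proof. by rewrite /= (prim_expr_mod prim_zeta) exprD. Qed.

Lemma prim_exprMn_residue i l : zeta ^+ (i *+ l)%R = (zeta ^+ i) ^+ l.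
Proof.
by elim: l => [|l IHl]; rewrite ?expr0 // mulrS prim_exprD_residue IHl exprS.
Qed.

Lemma prim_exprN_residue i : zeta ^+ (- i)%R = (zeta ^+ i)^-1.
Proof.
have inv_i : zeta ^+ i * zeta ^+ (- i)%R = 1.
  by rewrite -prim_exprD_residue subrr.
have nz_i : zeta ^+ i != 0.
  by apply: contra_eq_neq inv_i => ->; rewrite mul0r eq_sym oner_eq0.
by apply: (mulfI nz_i); rewrite inv_i mulfV.
Qed.

Lemma prim_expr_residue_inj : injective (fun i => zeta ^+ i).
Proof.
move=> i j /eqP; rewrite (eq_prim_root_expr prim_zeta) !modn_small //.
by move/eqP/val_inj.
Qed.

End ResiduePowers.

(** * Cyclotomic classes and the orbits of sigma *)

Section CyclotomicClasses.

Variables (N q k T : nat).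
(* Coprimality of q and n0; the classes need it for q^k, and sigma for q^T. *)
Hypothesis mulq_inj : forall s, injective (fun i : 'I_N.+1 => i *+ (q ^ s)%N).

Local Notation n0 := N.+1.
Local Notation cls := (@cyclotomic_class n0 q k).
Local Notation classes := (cyclotomic_classes n0 q k).
Local Notation sigma := (@sigma n0 q T).

Lemma cyclotomic_class_refl i : i \in cls i.
Proof. by rewrite inE in_orbit. Qed.

Lemma mem_cyclotomic_class i j : (j \in cls i) = (cls j == cls i).
Proof.
have symq := fconnect_sym (@mulq_inj k).
rewrite inE -fconnect_orbit; apply/idP/eqP => [ij | eq_ji].
  by apply/setP=> l; rewrite !inE -!fconnect_orbit (same_connect symq ij).
have := cyclotomic_class_refl j.
by rewrite eq_ji inE -fconnect_orbit.
Qed.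

Lemma cyclotomic_class_mem i : cls i \in classes.
Proof. exact: imset_f. Qed.

Lemma sigma_inj : injective sigma.
Proof. by apply: imset_inj => i j /oppr_inj/mulq_inj. Qed.

(** Multiplication by - q^T commutes with multiplication by q^k. *)
Lemma sigma_cyclotomic_class i : sigma (cls i) = cls (- (i *+ (q ^ T)%N)).
Proof.
have iterE l j : iter l (fun l : 'I_n0 => l *+ (q ^ k)%N) (- (j *+ (q ^ T)%N))
    = - (iter l (fun l : 'I_n0 => l *+ (q ^ k)%N) j *+ (q ^ T)%N).
  by elim: l => //= l ->; rewrite mulNrn mulrnAC.
apply/setP=> j; apply/imsetP/idP => [[l] | ].
  rewrite !inE -!fconnect_orbit => il ->; rewrite -(iter_findex il) -iterE.
  exact: fconnect_iter.
rewrite inE -fconnect_orbit => ij; rewrite -(iter_findex ij) iterE.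
by eexists; last reflexivity; rewrite inE -fconnect_orbit fconnect_iter.
Qed.

Lemma prod_class_poly (L : fieldType) (zeta : L) (a : {set 'I_n0} -> nat) :
  \prod_(R in classes) class_poly (n0 := n0) zeta R ^+ a R =
  \prod_(i : 'I_n0) ('X - (zeta ^+ i)%:P) ^+ a (cls i).
Proof.
rewrite [RHS](partition_big cls (mem classes)) /=; last first.
  by move=> i _; apply: cyclotomic_class_mem.
apply: eq_bigr => _ /imsetP[j _ ->]; rewrite -prodrXl.
by apply: eq_big => i; rewrite mem_cyclotomic_class // => /eqP->.
Qed.

Variable reps : {set {set 'I_n0}}.
Hypothesis reps_tr : is_transversal reps (sigma_orbits n0 q k T) classes.

Local Notation sorbit := (@sigma_orbit n0 q T).
Local Notation Om1 := (@Omega1 n0 q T reps).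
Local Notation Om2 := (@Omega2 n0 q T reps).

Let orbits_partition : partition (sigma_orbits n0 q k T) classes.
Proof. by case/and3P: reps_tr. Qed.

Lemma sigma_orbit_refl Q : Q \in sorbit Q.
Proof. by rewrite inE in_orbit. Qed.

Lemma pblock_reps Q : Q \in reps -> pblock (sigma_orbits n0 q k T) Q = sorbit Q.
Proof.
move=> repQ; case/and3P: orbits_partition => _ triv _.
apply: def_pblock (sigma_orbit_refl Q) => //.
exact/imset_f/(subsetP (transversal_sub reps_tr)).
Qed.

(** The orbits of sigma partition the classes and reps picks one class in each;
a one-element orbit is the singleton of its representative. *)
Lemma prod_sigma_orbits (A : comNzRingType) (E : {set 'I_n0} -> A) :
  \prod_(R in classes) E R =
  (\prod_(Q in Om1) E Q) * \prod_(Q in Om2) \prod_(R in sorbit Q) E R.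
Proof.
case/and3P: (orbits_partition) => /eqP coverE triv _.
rewrite -{1}coverE big_trivIset //= -(pblock_transversal reps_tr).
rewrite big_imset /=; last exact: pblock_inj reps_tr.
rewrite (bigID (fun Q => #|sorbit Q| == 1%N)) /=; congr (_ * _).
  apply: eq_big => Q; first by rewrite inE.
  case/andP=> repQ /cards1P[Q' defO]; rewrite pblock_reps //.
  have:= sigma_orbit_refl Q; rewrite defO => /set1P ->.
  by rewrite big_set1.
apply: eq_big => [Q | Q /andP[/pblock_reps-> //]].
rewrite inE; congr (_ && _); rewrite ltn_neqAle eq_sym andbC.
by rewrite (cardsD1 Q) sigma_orbit_refl.
Qed.

Lemma sigma_Omega1 Q : Q \in Om1 -> Q \in classes /\ sigma Q = Q.
Proof.
rewrite inE => /andP[repQ /cards1P[Q' defO]].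
split; first exact: (subsetP (transversal_sub reps_tr)).
have /set1P QQ' : Q \in [set Q'] by rewrite -defO sigma_orbit_refl.
have /set1P sQQ' : sigma Q \in [set Q'].
  by rewrite -defO inE mem_orbit ?in_orbit.
by rewrite sQQ'.
Qed.

Lemma Omega2_sigma_orbit Q R : Q \in Om2 -> R \in sorbit Q -> R \in classes.
Proof.
rewrite inE => /andP[repQ _] QR; case/and3P: (orbits_partition) => /eqP <- _ _.
apply/bigcupP; exists (sorbit Q) => //.
exact/imset_f/(subsetP (transversal_sub reps_tr)).
Qed.

Lemma sigma_orbit_cover R : R \in classes ->
  R \in Om1 \/ (exists2 Q, Q \in Om2 & R \in sorbit Q).
Proof.
case/and3P: (orbits_partition) => /eqP <- _ _.
rewrite -(pblock_transversal reps_tr).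
case/bigcupP => _ /imsetP[Q repQ ->]; rewrite pblock_reps // => QR.
case: (boolP (Q \in Om2)) => [Om2Q | ]; first by right; exists Q.
rewrite inE repQ -leqNgt /= => O_le1; left.
have/eqP defO : [set Q] == sorbit Q.
  by rewrite eqEcard sub1set sigma_orbit_refl cards1.
by move: (QR); rewrite -defO => /set1P->; rewrite inE repQ -defO cards1 eqxx.
Qed.

(** The relation a (sigma R) + a R = 2^r couples neighbours along each orbit of
sigma. On a fixed class it reads 2 a_Q = 2^r, and on longer orbits it is the
recurrence of the conclusion shifted by one step. *)
Lemma sigma_pairing_Omega (a : {set 'I_n0} -> nat) (r : nat) : (0 < r)%N ->
    (forall R, R \in classes -> (a R <= 2 ^ r)%N) ->
  (forall R, R \in classes -> (a (sigma R) + a R = 2 ^ r)%N) <->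
  (forall Q, Q \in Om1 -> a Q = (2 ^ r.-1)%N) /\
  (forall Q R, Q \in Om2 -> R \in sorbit Q ->
     a R = (2 ^ r - a (sigma_inv q T R))%N).
Proof.
move=> r_gt0 a_le; have half : (2 ^ r = (2 ^ r.-1).*2)%N.
  by rewrite -mul2n -expnS prednK.
have invK R : sigma (sigma_inv (n0 := n0) q T R) = R := f_finv sigma_inj R.
split=> [pair_a | [a_Om1 a_Om2] R].
  split=> [Q /sigma_Omega1[clQ sQ] | Q R Om2Q QR].
    by have := pair_a Q clQ; rewrite sQ addnn half => /double_inj.
  have QR' : sigma_inv q T R \in sorbit Q.
    move: QR; rewrite !inE -!fconnect_orbit => QR.
    exact: connect_trans QR (fconnect_finv _ _).
  by rewrite -(pair_a _ (Omega2_sigma_orbit Om2Q QR')) invK addnK.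
move=> clR; case: (sigma_orbit_cover clR) => [Om1R | [Q Om2Q QR]].
  by have [_ ->] := sigma_Omega1 Om1R; rewrite a_Om1 // addnn half.
rewrite (a_Om2 Q) //; last by move: QR; rewrite !inE => /mem_orbit.
by rewrite /sigma_inv (finv_f sigma_inj) subnK // a_le.
Qed.

End CyclotomicClasses.

(** * The characterization *)

Theorem theorem32 (nu r n0 k T q n : nat)
  (nu_gt0 : (0 < nu)%N) (r_gt0 : (0 < r)%N) (odd_n0 : odd n0)
  (def_q : q = (2 ^ nu)%N) (def_n : n = (n0 * 2 ^ r)%N) (lt_Tk : (T < k)%N)
  (F : finFieldType) (card_F : #|F| = (q ^ k)%N)
  (L : fieldType) (iota : {rmorphism F -> L})
  (zeta : L) (prim_zeta : n0.-primitive_root zeta)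
  (reps : {set {set residue n0}})
  (reps_transversal : is_transversal reps (sigma_orbits n0 q k T)
                                          (cyclotomic_classes n0 q k))
  (a : {set residue n0} -> nat)
  (a_le1 : forall Q, Q \in Omega1 q T reps -> (a Q <= 2 ^ r)%N)
  (a_le2 : forall Q R, Q \in Omega2 q T reps -> R \in sigma_orbit q T Q ->
             (a R <= 2 ^ r)%N)
  (g : {poly F}) (g_monic : g \is monic) (g_dvd : g %| 'X^n - 1)
  (def_g : map_poly iota g =
     (\prod_(Q in Omega1 q T reps) class_poly zeta Q ^+ a Q) *
     (\prod_(Q in Omega2 q T reps) \prod_(R in sigma_orbit q T Q)
        class_poly zeta R ^+ a R)) :
  theta_self_dual (fun alpha : F => alpha ^+ (q ^ T)%N) (cyclic_code n g) <->
    (forall Q, Q \in Omega1 q T reps -> a Q = (2 ^ r.-1)%N) /\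
    (forall Q R, Q \in Omega2 q T reps -> R \in sigma_orbit q T Q ->
       a R = (2 ^ r - a (sigma_inv q T R))%N).
Proof.
case: n0 odd_n0 def_n prim_zeta reps reps_transversal a a_le1 a_le2 def_g
  => // N _ def_n prim_zeta reps reps_tr a a_le1 a_le2 def_g.
have charF : 2 \in [pchar F].
  by apply: (@card_finPcharP _ 2 (nu * k)); rewrite // card_F def_q expnM.
have charL : 2 \in [pchar L] by rewrite (fmorph_pchar iota).
have qX s : (q ^ s = 2 ^ (nu * s))%N by rewrite def_q expnM.
pose x (i : 'I_N.+1) := zeta ^+ i.
have x_inj : injective x := prim_expr_residue_inj prim_zeta.
have xMq s (i : 'I_N.+1) :
    x (i *+ (q ^ s)%N) = frobenius_pow charL (nu * s) (x i).
  by rewrite /x prim_exprMn_residue // qX.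
(* The Frobenius map of L is injective on the powers of zeta. *)
have mulq_inj s : injective (fun i : 'I_N.+1 => i *+ (q ^ s)%N).
  by move=> i j /(congr1 x); rewrite !xMq => /fmorph_inj/x_inj.
have n_gt0 : (0 < n)%N by rewrite def_n muln_gt0 expn_gt0.
have n1_neq0 : n.-1%:R != 0 :> L.
  (* n is even, so n - 1 is -1 in L. *)
  have : n%:R = 0 :> L.
    apply/eqP; rewrite -(dvdn_pcharf charL) def_n dvdn_mull //.
    exact: dvdn_exp.
  apply: contra_eq_neq => n1_0.
  by rewrite -(prednK n_gt0) -addn1 natrD n1_0 add0r oner_eq0.
have Xn_sub1_prod :
    'X^n - 1 = \prod_(i : 'I_N.+1) ('X - (x i)%:P) ^+ (2 ^ r) :> {poly L}.
  rewrite prodrXl; have := factor_Xn_sub_1 prim_zeta; rewrite big_mkord => ->.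
  have charPL : 2 \in [pchar {poly L}] by rewrite pchar_poly.
  have := rmorphB (frobenius_pow charPL r) 'X^(N.+1) 1.
  by rewrite /= /frobenius_pow expr1n -exprM -def_n.
have a_le R : R \in cyclotomic_classes N.+1 q k -> (a R <= 2 ^ r)%N.
  case/(sigma_orbit_cover reps_tr) => [|[Q]]; first exact: a_le1.
  exact: a_le2.
rewrite -(prod_sigma_orbits reps_tr) prod_class_poly // in def_g.
have x_unity i : x i ^+ n = 1.
  by rewrite exprAC def_n exprM (prim_expr_order prim_zeta) !expr1n.
pose m (i : 'I_N.+1) := a (@cyclotomic_class N.+1 q k i).
have self_dualE :
    theta_self_dual (fun alpha : F => alpha ^+ (q ^ T)%N) (cyclic_code n g) <->
    forall i : 'I_N.+1, (m (- (i *+ (q ^ T)%N))%R + m i = 2 ^ r)%N.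
  rewrite [in X in X <-> _]qX.
  apply: (@theta_self_dual_mup F L iota (frobenius_pow charF (nu * T))
    (frobenius_pow charL (nu * T)) _ n (2 ^ r) n_gt0 n1_neq0 _ x
    (fun i => i *+ (q ^ T)%N) (fun i => - (i *+ (q ^ T)%N))) => //.
  - by move=> z; rewrite /= /frobenius_pow rmorphXn.
  - by move=> i; rewrite /= -xMq /x prim_exprN_residue.
apply: iff_trans self_dualE _.
apply: iff_trans (sigma_pairing_Omega mulq_inj reps_tr r_gt0 a_le).
split=> [pair_a _ /imsetP[i _ ->] | pair_a i].
  by rewrite sigma_cyclotomic_class pair_a.
have := pair_a _ (cyclotomic_class_mem q k i).
by rewrite sigma_cyclotomic_class.
Qed.
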